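(* Let $p$ be an odd prime and $t\in\mathbb{N}$ with $1\le t\le p-1$. Let $y_1,\dots,y_{2t}\in\mathbb{Z}$, let $f=\sum_{j=1}^t a_jx^{\alpha_j}\in\mathbb{Z}[x]$ (with $a_j\in\mathbb{Z}$, $\alpha_j\in\mathbb{N}_0$), and let $x_1,\dots,x_{2t}\in\mathbb{Z}$ satisfy: (i) $f(x_i)\equiv y_i \pmod p$ for $1\le i\le 2t$; (ii) $\Delta_p f(x_1,\dots,x_{2t})\not\equiv 0\pmod p$, where $$\Delta_p f(x_1,\dots,x_{2t}):=\det\begin{pmatrix} x_1^{\alpha_1}&\cdots&x_1^{\alpha_t}& a_1e_2(x_1)x_1^{\alpha_1}&\cdots& a_te_2(x_1)x_1^{\alpha_t}\\ \vdots&&\vdots&\vdots&&\vdots\\ x_{2t}^{\alpha_1}&\cdots&x_{2t}^{\alpha_t}& a_1e_2(x_{2t})x_{2t}^{\alpha_1}&\cdots& a_te_2(x_{2t})x_{2t}^{\alpha_t}\end{pmatrix} \pmod p.$$ Then for every $k\in\mathbb{N}_0$ there exists $f_k=\sum_{j=1}^t a_{k,j}x^{\alpha_{k,j}}\in\mathbb{Z}[x]$ such that simultaneously $f_k(x_i)\equiv y_i\pmod{p^{2^k}}$ for $1\le i\le 2t$, and $a_{k,j}\equiv a_j\pmod p$, $\alpha_{k,j}\equiv\alpha_j\pmod{p-1}$ for $1\le j\le t$. Furthermore, if $f_k=\sum_{j=1}^t a_{k,j}x^{\alpha_{k,j}}$ and $g_k=\sum_{j=1}^t b_{k,j}x^{\beta_{k,j}}$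 in $\mathbb{Z}[x]$ are two such polynomials, then $a_{k,j}\equiv b_{k,j}\pmod{p^{2^k}}$ and $\alpha_{k,j}\equiv\beta_{k,j}\pmod{\varphi(p^{2^k})}$ for $1\le j\le t$, where $\varphi$ is Euler's totient function.
   Context: For an odd prime $p$, the map $e_2:\mathbb{Z}\to\mathbb{Z}/p\mathbb{Z}$ is defined as follows: if $p\nmid x$, $e_2(x)$ is the class modulo $p$ of $(x^{p-1}-1)/p$, i.e. $x^{p-1}\equiv 1+p\,e_2(x)\pmod{p^2}$; if $p\mid x$, $e_2(x)=0$.
   Formalization: The formal theorem additionally assumes that p divides no x_i; without this the claim fails (p=3, t=1, f=x^0, x=(3,2), y=(1,4), k=1), and the assumption follows from (ii) whenever all exponents α_j are at least 1. *)

(* Defs.v *)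
From HB Require Import structures.
From mathcomp Require Import all_boot all_order all_algebra.

Set Implicit Arguments.
Unset Strict Implicit.
Unset Printing Implicit Defensive.

Import Order.TTheory GRing.Theory Num.Theory.
Local Open Scope ring_scope.

(* The integer division is exact by Fermat's little theorem. *)
Definition e2 (p : nat) (x : int) : 'F_p :=
  if (p %| x)%Z then 0 else ((x ^+ p.-1 - 1) %/ p)%Z%:~R.

(* A sum of t terms is handled through its coefficients and exponents, since
   the lifting conditions refer to them term by term; neither the a j nor the
   alpha j are required to be distinct or nonzero. *)
Definition sparse_poly (t : nat) (a : 'I_t -> int) (alpha : 'I_t -> nat) :
    {poly int} :=
  \sum_(j < t) a j *: 'X^(alpha j).

(* The 2t interpolation points are indexed by 'I_(t + t), so that the two
   t-column blocks can be put side by side with row_mx. *)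
Definition Delta (p t : nat) (a : 'I_t -> int) (alpha : 'I_t -> nat)
    (x : 'I_(t + t) -> int) : 'F_p :=
  \det (row_mx
    (\matrix_(i < t + t, j < t) ((x i)%:~R ^+ alpha j : 'F_p))
    (\matrix_(i < t + t, j < t)
       ((a j)%:~R * e2 p (x i) * (x i)%:~R ^+ alpha j : 'F_p))).

Definition is_lift (p t : nat) (a : 'I_t -> int) (alpha : 'I_t -> nat)
    (x y : 'I_(t + t) -> int) (k : nat)
    (b : 'I_t -> int) (beta : 'I_t -> nat) : Prop :=
  [/\ forall i, ((sparse_poly b beta).[x i] = y i %[mod (p ^ (2 ^ k))%N])%Z,
      forall j, (b j = a j %[mod p])%Z
    & forall j, (beta j = alpha j %[mod p.-1])%N].

(* Main.v *)
(** Hensel lifting, one power of p at a time. If x ^ (p - 1) = 1 + p e mod p^2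
    and p is odd, then x ^ ((p - 1) p^m) = 1 + p^(m + 1) e mod p^(m + 2). So
    replacing a_j by a_j + p^(m + 1) c_j and alpha_j by
    alpha_j + (p - 1) p^m h_j changes the value at x_i, modulo p^(m + 2), by
    p^(m + 1) times the i-th entry of the product of the matrix defining
    Delta_p f with the column vector (c, h). As this matrix is invertible
    modulo p, passing from p^(m + 1) to p^(m + 2) amounts to solving a
    nonsingular linear system over F_p. *)

Require Import Defs.
From mathcomp Require Import all_boot all_order all_algebra finfield.
From mathcomp Require Import ring.

Set Implicit Arguments.
Unset Strict Implicit.
Unset Printing Implicit Defensive.

Import Order.TTheory GRing.Theory Num.Theory.
Local Open Scope ring_scope.

(** The expansion stops at order three because, for [u] divisible by p^(m+1), the cubic remainder is
    divisible by p^(m+3); only the quadratic term then needs care when raising to the power [p]. *)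
Lemma expr_1D_mod_cube (R : comNzRingType) (u : R) (n : nat) :
  exists w, (1 + u) ^+ n = 1 + u *+ n + u ^+ 2 *+ 'C(n, 2) + u ^+ 3 * w.
Proof.
elim: n => [|n [w IHn]]; first by exists 0; rewrite expr0 !mulr0n mulr0 !addr0.
exists (w + u * w + 'C(n, 2)%:R).
rewrite exprS IHn binS bin1; ring.
Qed.

Lemma Fp_intr_eq0 (p : nat) (z : int) : prime p ->
  ((z%:~R : 'F_p) == 0) = (p %| z)%Z.
Proof. by move=> p_pr; rewrite -(dvdz_pcharf (pchar_Fp p_pr)). Qed.

Lemma Fp_intr_eq (p : nat) (z1 z2 : int) : prime p ->
  ((z1%:~R : 'F_p) == z2%:~R) = (z1 == z2 %[mod p])%Z.
Proof.
by move=> p_pr; rewrite eqz_mod_dvd -Fp_intr_eq0 // rmorphB subr_eq0.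
Qed.

Lemma Fp_expr_pred (p : nat) (z : 'F_p) : prime p -> z != 0 -> z ^+ p.-1 = 1.
Proof.
move=> p_pr z_neq0; apply: (mulfI z_neq0).
rewrite -exprS mulr1 prednK ?prime_gt0 //.
by have := expf_card z; rewrite card_Fp.
Qed.

Lemma Fp_expr_modn (p n1 n2 : nat) (z : 'F_p) : prime p -> z != 0 ->
  n1 = n2 %[mod p.-1] -> z ^+ n1 = z ^+ n2.
Proof.
move=> p_pr z_neq0 eq_n; rewrite (divn_eq n1 p.-1) (divn_eq n2 p.-1) eq_n.
by rewrite !exprD ![(_ * p.-1)%N]mulnC !exprM Fp_expr_pred // !expr1n.
Qed.

Lemma e2_fermat (p : nat) (x : int) : prime p -> ~~ (p %| x)%Z ->
  exists2 e : int, e2 p x = e%:~R & x ^+ p.-1 = 1 + p%:Z * e.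
Proof.
move=> p_pr p'x; exists ((x ^+ p.-1 - 1) %/ p)%Z.
  by rewrite /e2 (negPf p'x).
have dvd_p: (p %| x ^+ p.-1 - 1)%Z.
  rewrite -Fp_intr_eq0 // rmorphB rmorphXn /=.
  by rewrite Fp_expr_pred ?subrr // Fp_intr_eq0.
by rewrite [p%:Z * _]mulrC divzK // addrC subrK.
Qed.

(** Induction on [m] by raising to the power [p]: the linear term gains one factor [p], and the
    higher terms alter [e] by a multiple of [p]. Thus [e] depends on [m], but its class modulo [p]
    does not. *)
Lemma expz_e2 (p m : nat) (x : int) : prime p -> odd p -> ~~ (p %| x)%Z ->
  exists2 e : int, e2 p x = e%:~R &
    x ^+ (p.-1 * p ^ m) = 1 + p%:Z ^+ m.+1 * e.
Proof.
move=> p_pr p_odd p'x; elim: m => [|m [e De IHm]].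
  by rewrite muln1; apply: e2_fermat.
rewrite expnSr mulnA exprM IHm.
have [w ->] := expr_1D_mod_cube (p%:Z ^+ m.+1 * e) p.
have p_gt2: (2 < p)%N by exact: odd_prime_gt2.
(* Oddness of [p] enters here: for [m = 0] the quadratic term needs this extra factor [p]. *)
have /dvdnP[q Dq]: (p %| 'C(p, 2))%N by rewrite prime_dvd_bin.
exists (e + p%:Z * (p%:Z ^+ m * q%:Z * e ^+ 2 + p%:Z ^+ (m + m) * e ^+ 3 * w)).
  by rewrite rmorphD rmorphM /= -pmulrn (pcharf0 (pchar_Fp p_pr)) mul0r addr0.
rewrite Dq -[X in _ + X + _]mulr_natr -[X in 1 + X]mulr_natr natrM !natz.
rewrite !exprS exprD; ring.
Qed.

Lemma expz_shift_nat (p m n h : nat) (x : int) :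
  prime p -> odd p -> ~~ (p %| x)%Z ->
  exists2 e : int, e2 p x = e%:~R &
    (p%:Z ^+ m.+2 %| x ^+ (n + h * (p.-1 * p ^ m))
                      - x ^+ n * (1 + p%:Z ^+ m.+1 * (h%:Z * e)))%Z.
Proof.
move=> p_pr p_odd p'x; have [e De eqx] := expz_e2 m p_pr p_odd p'x.
exists e => //; rewrite exprD mulnC exprM eqx.
have [w ->] := expr_1D_mod_cube (p%:Z ^+ m.+1 * e) h.
apply/dvdzP; exists (x ^+ n * p%:Z ^+ m * e ^+ 2 *
  ('C(h, 2)%:Z + p%:Z ^+ m.+1 * e * w)).
rewrite -[X in _ + X + _]mulr_natr -[X in 1 + X]mulr_natr !natz !exprS.
ring.
Qed.

(** A signed [h] serves uniqueness, where either of the two exponents may be the larger. For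
    negative [h], [n] and [n'] swap roles, and 1 + p^(m+1) s is inverted modulo p^(m+2) by 1 -
    p^(m+1) s. *)
Lemma expz_shift (p m n n' : nat) (h x : int) :
  prime p -> odd p -> ~~ (p %| x)%Z ->
  n'%:Z = n%:Z + h * (p.-1 * p ^ m)%N%:Z ->
  exists2 e : int, e2 p x = e%:~R &
    (p%:Z ^+ m.+2 %| x ^+ n' - x ^+ n * (1 + p%:Z ^+ m.+1 * (h * e)))%Z.
Proof.
move=> p_pr p_odd p'x; case: h => [h | h] eq_n.
  have ->: n' = (n + h * (p.-1 * p ^ m))%N by apply/eqP; rewrite -eqz_nat eq_n.
  exact: expz_shift_nat.
have ->: n = (n' + h.+1 * (p.-1 * p ^ m))%N.
  by apply/eqP; rewrite -eqz_nat PoszD PoszM eq_n NegzE; apply/eqP; ring.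
have [e De /dvdzP[q Dq]] := expz_shift_nat m n' h.+1 p_pr p_odd p'x.
exists e => //; rewrite NegzE.
move/eqP: Dq; rewrite subr_eq => /eqP->.
apply/dvdzP; exists (- q * (1 - p%:Z ^+ m.+1 * (h.+1%:Z * e))
   + x ^+ n' * p%:Z ^+ m * (h.+1%:Z * e) ^+ 2).
rewrite !exprS.
ring.
Qed.

Lemma horner_sparse_poly (t : nat) (a : 'I_t -> int) (alpha : 'I_t -> nat)
    (x : int) : (sparse_poly a alpha).[x] = \sum_(j < t) a j * x ^+ alpha j.
Proof.
by rewrite horner_sum; apply: eq_bigr => j _; rewrite hornerZ hornerXn.
Qed.

Definition Delta_mx (p t : nat) (a : 'I_t -> int) (alpha : 'I_t -> nat)
    (x : 'I_(t + t) -> int) : 'M['F_p]_(t + t) :=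
  row_mx
    (\matrix_(i < t + t, j < t) ((x i)%:~R ^+ alpha j : 'F_p))
    (\matrix_(i < t + t, j < t)
       ((a j)%:~R * e2 p (x i) * (x i)%:~R ^+ alpha j : 'F_p)).

Definition int_col (p t : nat) (c : 'I_t -> int) : 'cV['F_p]_t :=
  \col_j (c j)%:~R.

(** Nonnegative representatives keep the shifted exponents in [nat] when a lift is constructed. *)
Lemma int_col_surj (p t : nat) (v : 'cV['F_p]_t) :
  exists h : 'I_t -> nat, v = int_col p (fun j => (h j)%:Z).
Proof.
exists (fun j => val (v j 0)); apply/matrixP => j k.
by rewrite (ord1 k) mxE -[RHS]/((val (v j 0))%:R) natr_Zp.
Qed.

(** The matrix is built from the initial [a] and [alpha], not from [b] and [beta]: its entries
    depend only on coefficients modulo [p] and, by Fermat, on exponents modulo [p.-1]. Hence one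
    matrix serves every lifting step. *)
Lemma horner_sparse_poly_shift (p t m : nat)
    (a b b' c h : 'I_t -> int) (alpha beta beta' : 'I_t -> nat)
    (x : 'I_(t + t) -> int) (i : 'I_(t + t)) :
  prime p -> odd p -> ~~ (p %| x i)%Z ->
  (forall j, (b j = a j %[mod p])%Z) ->
  (forall j, beta j = alpha j %[mod p.-1]) ->
  (forall j, b' j = b j + c j * p%:Z ^+ m.+1) ->
  (forall j, (beta' j)%:Z = (beta j)%:Z + h j * (p.-1 * p ^ m)%N%:Z) ->
  exists2 d : int,
    (Delta_mx p a alpha x *m col_mx (int_col p c) (int_col p h)) i 0 = d%:~R &
    (p%:Z ^+ m.+2 %| (sparse_poly b' beta').[x i]
       - ((sparse_poly b beta).[x i] + p%:Z ^+ m.+1 * d))%Z.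
Proof.
move=> p_pr p_odd p'x eq_b eq_beta Db' Dbeta'.
have [e De _] := expz_e2 m p_pr p_odd p'x.
pose d j := (c j + h j * b j * e) * x i ^+ beta j.
exists (\sum_j d j).
  rewrite mul_row_col !mxE -big_split rmorph_sum /=; apply: eq_bigr => j _.
  have xp_neq0: ((x i)%:~R : 'F_p) != 0 by rewrite Fp_intr_eq0.
  rewrite !mxE; have /eqP <-: ((b j)%:~R : 'F_p) == (a j)%:~R.
    by rewrite Fp_intr_eq // eq_b.
  rewrite /d De -(Fp_expr_modn p_pr xp_neq0 (eq_beta j)).
  rewrite !(rmorphM, rmorphD, rmorphXn) /=.
  ring.
rewrite !horner_sparse_poly mulr_sumr -big_split -sumrB /=.
apply: rpred_sum => j _.
(* This representative of [e2 p (x i)] may vary with [j]; replacing it by the common [e] costs a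
   multiple of p^(m+2), as the term carries p^(m+1). *)
have [e' De' /dvdzP[q Dq]] := expz_shift p_pr p_odd p'x (Dbeta' j).
have /dvdzP[r Dr]: (p %| e' - e)%Z.
  by rewrite -Fp_intr_eq0 // rmorphB /= -De -De' subrr.
move/eqP: Dq; rewrite subr_eq => /eqP->.
move/eqP: Dr; rewrite subr_eq => /eqP->.
(* The quotient collects the error on the power of [x i], the change from [e'] to [e], and the
   product of the two first-order changes, which carries p^(2m+2). *)
apply/dvdzP; exists (b' j * q + x i ^+ beta j * h j *
  (b j * r + c j * p%:Z ^+ m * (r * p%:Z + e))).
rewrite Db' /d !exprS.
ring.
Qed.

(** Allows every power of [p], so that induction can climb one power at a time; [is_lift] is the
    case of exponent [2 ^ k]. *)
Definition is_lift_mod (p t : nat) (a : 'I_t -> int) (alpha : 'I_t -> nat)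
    (x y : 'I_(t + t) -> int) (m : nat)
    (b : 'I_t -> int) (beta : 'I_t -> nat) : Prop :=
  [/\ forall i, ((sparse_poly b beta).[x i] = y i %[mod (p ^ m)%N])%Z,
      forall j, (b j = a j %[mod p])%Z
    & forall j, (beta j = alpha j %[mod p.-1])%N].

Lemma Posz_expn (p m : nat) : (p ^ m)%N%:Z = p%:Z ^+ m.
Proof. by rewrite -natz natrX natz. Qed.

Lemma is_lift_modS (p t : nat) (a : 'I_t -> int) (alpha : 'I_t -> nat)
    (x y : 'I_(t + t) -> int) (m : nat) (b : 'I_t -> int)
    (beta : 'I_t -> nat) :
  is_lift_mod p a alpha x y m.+1 b beta -> is_lift_mod p a alpha x y m b beta.
Proof.
case=> eq_y eq_b eq_beta; split=> // i; move/eqP: (eq_y i).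
rewrite !eqz_mod_dvd !Posz_expn => dvd_y; apply/eqP.
rewrite eqz_mod_dvd; apply: dvdz_trans dvd_y.
by rewrite exprSr dvdz_mulr.
Qed.

Lemma lift_mod_exists (p t : nat) (a : 'I_t -> int) (alpha : 'I_t -> nat)
    (x y : 'I_(t + t) -> int) (m : nat) :
  prime p -> odd p -> (forall i, ~~ (p %| x i)%Z) ->
  (forall i, ((sparse_poly a alpha).[x i] = y i %[mod p])%Z) ->
  Delta p a alpha x != 0 ->
  exists b beta, is_lift_mod p a alpha x y m.+1 b beta.
Proof.
move=> p_pr p_odd p'x f_interp Delta_neq0.
elim: m => [|m [b [beta [eq_y eq_b eq_beta]]]].
  by exists a, alpha; split=> // i; rewrite expn1.
have unitM: Delta_mx p a alpha x \in unitmx by rewrite unitmxE unitfE.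
have /fin_all_exists[r Dr] i: exists r,
    y i - (sparse_poly b beta).[x i] = r * p%:Z ^+ m.+1.
  by apply/dvdzP; rewrite -Posz_expn -eqz_mod_dvd eq_y.
(* [r] is the interpolation error divided by p^(m+1). The upper half of the solution corrects the
   coefficients, the lower half the exponents. *)
pose v := invmx (Delta_mx p a alpha x) *m int_col p r.
have [c Dc] := int_col_surj (usubmx v).
have [h Dh] := int_col_surj (dsubmx v).
pose b' j := b j + (c j)%:Z * p%:Z ^+ m.+1.
pose beta' j := (beta j + h j * (p.-1 * p ^ m))%N.
exists b', beta'; split=> [i | j | j].
- have Dbeta' j : (beta' j)%:Z = (beta j)%:Z + (h j)%:Z * (p.-1 * p ^ m)%N%:Z.
    by rewrite -PoszM -PoszD.
  have [d] := horner_sparse_poly_shift p_pr p_odd (p'x i) eq_b eq_beta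
    (fun j => erefl (b' j)) Dbeta'.
  rewrite -Dc -Dh vsubmxK /v mulKVmx // mxE => /eqP.
  rewrite Fp_intr_eq // eqz_mod_dvd => /dvdzP[q Dq] /dvdzP[s Ds].
  apply/eqP; rewrite eqz_mod_dvd Posz_expn.
  move/eqP: Ds; rewrite subr_eq => /eqP->.
  move/eqP: (Dr i); rewrite subr_eq => /eqP->.
  move/eqP: Dq; rewrite subr_eq => /eqP->.
  by apply/dvdzP; exists (s - q); rewrite !exprS; ring.
- rewrite -eq_b; apply/eqP; rewrite eqz_mod_dvd /b' addrC addKr.
  by rewrite exprSr dvdz_mull ?dvdz_mull.
- by rewrite -eq_beta /beta' mulnCA addnC [(p.-1 * _)%N]mulnC modnMDl.
Qed.

(** At [m = 0] the congruences required of a lift suffice. Afterwards, the differences [c] and [h],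
    scaled by p^(m+1) and (p-1) p^m, form a vector in the kernel of the invertible matrix, so [p]
    divides both and one more power is gained. *)
Lemma lift_mod_unique (p t : nat) (a : 'I_t -> int) (alpha : 'I_t -> nat)
    (x y : 'I_(t + t) -> int) (m : nat) (b b' : 'I_t -> int)
    (beta beta' : 'I_t -> nat) :
  prime p -> odd p -> (forall i, ~~ (p %| x i)%Z) ->
  Delta p a alpha x != 0 ->
  is_lift_mod p a alpha x y m.+1 b beta ->
  is_lift_mod p a alpha x y m.+1 b' beta' ->
  forall j, (p%:Z ^+ m.+1 %| b' j - b j)%Z /\
    ((p.-1 * p ^ m)%N %| (beta' j)%:Z - (beta j)%:Z)%Z.
Proof.
move=> p_pr p_odd p'x Delta_neq0.
elim: m => [|m IHm] lift_b lift_b' j.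
  case: lift_b lift_b' => [_ eq_b eq_beta] [_ eq_b' eq_beta'].
  split; first by rewrite expr1 -eqz_mod_dvd eq_b eq_b'.
  by rewrite muln1 -eqz_mod_dvd !modz_nat eqz_nat eq_beta eq_beta'.
have {}IHm := IHm (is_lift_modS lift_b) (is_lift_modS lift_b').
have /fin_all_exists[c Dc] i: exists c, b' i - b i = c * p%:Z ^+ m.+1.
  by apply/dvdzP; case: (IHm i).
have /fin_all_exists[h Dh] i: exists h,
    (beta' i)%:Z - (beta i)%:Z = h * (p.-1 * p ^ m)%N%:Z.
  by apply/dvdzP; case: (IHm i).
have unitM: Delta_mx p a alpha x \in unitmx by rewrite unitmxE unitfE.
case: lift_b lift_b' => [eq_y eq_b eq_beta] [eq_y' _ _].
have: col_mx (int_col p c) (int_col p h) = 0.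
  rewrite -[LHS](mulKmx unitM); set w := _ *m col_mx _ _.
  suff ->: w = 0 by rewrite mulmx0.
  apply/matrixP => i k; rewrite (ord1 k) [RHS]mxE.
  have Db' l: b' l = b l + c l * p%:Z ^+ m.+1 by rewrite -Dc addrC subrK.
  have Dbeta' l: (beta' l)%:Z = (beta l)%:Z + h l * (p.-1 * p ^ m)%N%:Z.
    by rewrite -Dh addrC subrK.
  have [d -> dvd_d] := horner_sparse_poly_shift p_pr p_odd (p'x i) eq_b eq_beta
    Db' Dbeta'.
  apply/eqP; rewrite Fp_intr_eq0 //.
  have pm_neq0: p%:Z ^+ m.+1 != 0.
    by rewrite expf_neq0 // eqz_nat -lt0n prime_gt0.
  (* Both lifts agree with [y i] modulo p^(m+2), so the first-order change p^(m+1) d vanishes there,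
     whence [p] divides [d]. *)
  rewrite -(dvdz_mul2l pm_neq0) -exprSr.
  move/eqP: (eq_y i); rewrite -eq_y' eq_sym eqz_mod_dvd Posz_expn => dvd_y.
  have := rpredB dvd_y dvd_d; congr (_ %| _)%Z; ring.
rewrite -(col_mx0 'F_p t t 1) => /eq_col_mx[/matrixP/(_ j 0) + /matrixP/(_ j 0)].
rewrite !mxE => /eqP + /eqP; rewrite !Fp_intr_eq0 //.
rewrite Dc Dh => dvd_c dvd_h; split.
  by rewrite [p%:Z ^+ m.+2]exprS dvdz_mul.
by rewrite expnS mulnCA (PoszM p) dvdz_mul.
Qed.

Theorem theorem1p6 (p t : nat) (p_prime : prime p) (p_odd : odd p)
    (t_bounds : (1 <= t <= p.-1)%N)
    (x y : 'I_(t + t) -> int) (a : 'I_t -> int) (alpha : 'I_t -> nat)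
    (x_unit : forall i, ~~ (p %| x i)%Z)
    (f_interp : forall i, ((sparse_poly a alpha).[x i] = y i %[mod p])%Z)
    (Delta_neq0 : Delta p a alpha x != 0) :
  forall k : nat,
    (exists (a_k : 'I_t -> int) (alpha_k : 'I_t -> nat),
        is_lift p a alpha x y k a_k alpha_k) /\
    (forall (a_k b_k : 'I_t -> int) (alpha_k beta_k : 'I_t -> nat),
        is_lift p a alpha x y k a_k alpha_k ->
        is_lift p a alpha x y k b_k beta_k ->
        forall j : 'I_t,
          (a_k j = b_k j %[mod (p ^ (2 ^ k))%N])%Z /\
          (alpha_k j = beta_k j %[mod totient (p ^ (2 ^ k))])%N).
Proof.
(* Since 2^k is positive, it is a successor, as the lemmas on lifts modulo p^(m+1) require. *)
move=> k; have Ek: (2 ^ k)%N = (2 ^ k).-1.+1 by rewrite prednK ?expn_gt0.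
split.
  rewrite /is_lift Ek; exact: lift_mod_exists.
move=> a_k b_k alpha_k beta_k; rewrite /is_lift Ek => lift_a lift_b j.
have [dvd_ab dvd_exp] :=
  lift_mod_unique p_prime p_odd x_unit Delta_neq0 lift_b lift_a j.
split; apply/eqP; first by rewrite eqz_mod_dvd Posz_expn.
(* The modulus (p-1) p^m for exponents is exactly the totient of p^(m+1). *)
by rewrite totient_pfactor // -eqz_nat -!modz_nat eqz_mod_dvd.
Qed.
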